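(* Let $X$ be a Hausdorff space and let $\mathcal{O}$ be the set of open covers of $X$. Then Bob has a winning strategy in $\mathsf{G}_{\mathrm{bnd}}(\mathcal{O},\mathcal{O})$ if, and only if, Bob has a winning strategy in $\mathsf{G}_1(\mathcal{O},\mathcal{O})\,\mathrm{mod}\,1$.
   Context: Here $\omega=\{0,1,2,\dots\}$. Let $\mathcal{A},\mathcal{B}$ be families of sets. The following games are played between Alice and Bob, with innings $n\in\omega$; in each inning $n$ Alice first chooses $A_n\in\mathcal{A}$ and then Bob responds with a finite $B_n\subset A_n$, each player knowing all previous moves. In $\mathsf{G}_{\mathrm{bnd}}(\mathcal{A},\mathcal{B})$, Bob wins if $\bigcup_{n\in\omega}B_n\in\mathcal{B}$ and there is a $k\in\omega$ such that $|B_n|\le k$ for every $n\in\omega$; otherwise Alice wins. In $\mathsf{G}_1(\mathcal{A},\mathcal{B})\,\mathrm{mod}\,1$, Bob wins if $\bigcup_{n\in\omega}B_n\in\mathcal{B}$ and $|B_n|\le 1$ for every $n\ge 1$ (only $B_0$ may have more than one element); otherwise Alice wins. *)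

(* Defs.v *)
From mathcomp Require Import all_boot all_classical topology.
Set Implicit Arguments.
Unset Strict Implicit.
Unset Printing Implicit Defensive.
Local Open Scope classical_set_scope.
Local Open Scope card_scope.

(* A history [:: (A_0, B_0); ...; (A_(n-1), B_(n-1))] lists the completed
   innings; given it and Alice's current move A_n, the strategy returns B_n. *)
Definition strategy (T : Type) := seq (set T * set T) -> set T -> set T.

Definition legal_strategy (T : Type) (AA : set (set T)) (s : strategy T) :=
  forall h A, AA A -> finite_set (s h A) /\ s h A `<=` A.

Definition follows (T : Type) (s : strategy T) (A B : nat -> set T) :=
  forall n, B n = s (mkseq (fun i => (A i, B i)) n) (A n).

(* The winning condition W only sees Bob's moves, as in both games below. *)
Definition bob_has_winning_strategy (T : Type) (AA : set (set T))
    (W : set (nat -> set T)) :=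
  exists s : strategy T, legal_strategy AA s /\
    forall A B : nat -> set T,
      (forall n, AA (A n)) -> follows s A B -> W B.

(* `I_k = {0, ..., k-1}, so C #<= `I_k says that C has at most k elements. *)
Definition G_bnd_won (T : Type) (BB : set (set T)) : set (nat -> set T) :=
  [set B | BB (\bigcup_n B n) /\ exists k : nat, forall n, B n #<= `I_k].

Definition G_1_mod_1_won (T : Type) (BB : set (set T)) : set (nat -> set T) :=
  [set B | BB (\bigcup_n B n) /\ forall n, (1 <= n)%N -> B n #<= `I_1].

Definition bob_wins_G_bnd (T : Type) (AA BB : set (set T)) :=
  bob_has_winning_strategy AA (G_bnd_won BB).

Definition bob_wins_G_1_mod_1 (T : Type) (AA BB : set (set T)) :=
  bob_has_winning_strategy AA (G_1_mod_1_won BB).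

Definition open_covers (X : topologicalType) : set (set (set X)) :=
  [set U | U `<=` open /\ \bigcup_(V in U) V = [set: X]].
Arguments open_covers : clear implicits.

(* Main.v *)
Require Import Defs.
From mathcomp Require Import all_boot finmap all_classical topology.
Set Implicit Arguments.
Unset Strict Implicit.
Unset Printing Implicit Defensive.

(** A strategy for the single-set game with a free first inning wins the bounded
    game as it stands, since its only large answer is finite.

    Conversely, let s be a winning strategy for Bob in the bounded game. As soon as
    Bob sees Alice's first cover A0, he imagines plays against s in which Alice
    only uses refinements of A0. After some finite sequence l0 of such covers all
    further answers of s have at most some fixed number k of elements, for
    otherwise Alice could force unbounded answers (eventually_bounded). The answers
    along l0 are finitely many sets, each contained in a member of A0, so a finite
    part of A0 covers all of them: this is the first move of Bob, and the reason
    why one free inning is enough.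

    What remains is to turn answers of size k into answers of size 1. At a position
    l after l0, let K be the set of points lying in the closure of the union of the
    answer of s to A, for every refinement A of A0. In a Hausdorff space K has at
    most k points (bounded_answers_finite), so Bob can cover it in finitely many
    innings, one point at a time. Outside the open set W covered so far, each point
    is in the complement of one of the closures; X is Lindelof because Bob wins
    (winning_lindelof), so countably many refinements A account for all points
    outside W. Bob therefore only needs to look after countably many positions, and
    can cover K at each of them. If some z were left uncovered, it would be missed
    by the answer of s to one of the chosen refinements at l0, then again at the
    next position, and so on (point_picker). That describes a play against s in
    which only the answers along l0 can cover z; as s wins, z is covered by the
    first move of Bob after all. *)

Local Open Scope classical_set_scope.
Local Open Scope card_scope.

(** * Bob's answers as a function of Alice's moves *)

Definition position (T : Type) (s : strategy T) (l : seq (set T)) :=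
  foldl (fun h A => rcons h (A, s h A)) [::] l.

Definition answer (T : Type) (s : strategy T) (l : seq (set T)) (A : set T) :=
  s (position s l) A.

Lemma follows_answer (T : Type) (s : strategy T) (A : nat -> set T) :
  follows s A (fun n => answer s (mkseq A n) (A n)).
Proof.
move=> n; rewrite /answer; congr (s _ _).
by elim: n => // n IHn; rewrite !mkseqS -IHn /position foldl_rcons.
Qed.

(** Chain the extensions: L k.+1 prolongs the one that meets P k at L k, and the
    limit of the increasing sequences L k has all of them as initial segments. *)
Lemma recurrent_extension (T : Type) (t0 : T) (P : nat -> seq T -> Prop) :
  (forall k l, exists l', P k (l ++ l')) ->
  exists t : nat -> T, forall k, exists n, P k (mkseq t n).
Proof.
move=> ext.
have /choice[e eP] (kl : nat * seq T) : exists l', P kl.1 (kl.2 ++ l').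
  exact: ext.
(* The extra t0 makes the lengths grow even when an extension is empty. *)
pose L := fix L k := if k is m.+1 then rcons (L m ++ e (m, L m)) t0 else [::].
have sizeL k : k <= size (L k).
  elim: k => //= k IHk; rewrite size_rcons size_cat ltnS.
  exact: leq_trans IHk (leq_addr _ _).
have L_cat a d : exists r, L (a + d) = L a ++ r.
  elim: d => [|d [r IHd]]; first by exists [::]; rewrite addn0 cats0.
  by rewrite addnS /= IHd rcons_cat -catA; eexists.
have nthL a b i : i < size (L a) -> i < size (L b) ->
    nth t0 (L a) i = nth t0 (L b) i.
  wlog ab : a b / a <= b => [H ia ib|ia _].
    by have [/H->//|/ltnW/H->] := leqP a b.
  by have [r] := L_cat a (b - a); rewrite subnKC// => ->; rewrite nth_cat ia.
pose t n := nth t0 (L n.+1) n.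
exists t => k; set l := L k ++ e (k, L k); exists (size l).
suff -> : mkseq t (size l) = l by exact: (eP (k, L k)).
apply: (@eq_from_nth _ t0) => [|i]; rewrite size_mkseq// => il.
rewrite nth_mkseq// /t (@nthL _ k.+1)//=; first by rewrite nth_rcons il.
by rewrite size_rcons ltnW.
Qed.

(** Otherwise, whatever has been played and for every k, Alice could go on so that
    some later answer has more than k elements; chaining such continuations for
    k = 0, 1, 2, ... yields a play without any bound. *)
Lemma eventually_bounded (X T : Type) (t0 : T) (c : T -> set X)
    (s : strategy X) :
  (forall t : nat -> T, exists k, forall n,
     answer s (mkseq (c \o t) n) (c (t n)) #<= `I_k) ->
  exists l0 k, forall l t, answer s (map c (l0 ++ l)) (c t) #<= `I_k.
Proof.
move=> bnd; apply: contrapT => noBound.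
pose P k l := exists l1 t,
  l = rcons l1 t /\ ~ (answer s (map c l1) (c t) #<= `I_k).
have [t tP] : exists t : nat -> T, forall k, exists n, P k (mkseq t n).
  apply: recurrent_extension => // k l0; apply: contrapT => noExt.
  apply: noBound; exists l0, k => l t.
  apply: contrapT => big; apply: noExt; exists (rcons l t), (l0 ++ l), t.
  by rewrite rcons_cat.
have [k kP] := bnd t; have [[|n] [l1 [t1 []]]] := tP k.
  by case: l1.
rewrite mkseqS => /rcons_inj[<- <-].
by rewrite /mkseq -map_comp; apply; exact: kP.
Qed.

(** * The Lindelof property *)

Definition lindelof (X : topologicalType) := forall U, open_covers X U ->
  exists V, [/\ V `<=` U, countable V & \bigcup_(A in V) A = [set: X]].

(** Answering the same cover forever, Bob extracts a countable subcover. *)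
Lemma winning_lindelof (X : topologicalType) :
  bob_wins_G_bnd (open_covers X) (open_covers X) -> lindelof X.
Proof.
move=> [s [sleg swin]] U oU.
have [[_ cover] _] := swin _ _ (fun=> oU) (follows_answer s (fun=> U)).
eexists; split; last exact: cover.
- by move=> A [n _ /(proj2 (sleg _ _ oU))].
- by apply: bigcup_countable => // n _; apply/finite_set_countable/(sleg _ _ oU).1.
Qed.

(** The complements of the closures, together with W, form an open cover; the
    closures rather than the sets N t themselves are what makes it open. *)
Lemma lindelof_closure_seq (X : topologicalType) (T : Type) (t0 : T)
    (N : T -> set X) (W : set X) :
  lindelof X -> open W -> \bigcap_t closure (N t) `<=` W ->
  exists e : nat -> T, forall z, ~ W z -> exists j, ~ closure (N (e j)) z.
Proof.
move=> lX oW KW; pose F t := ~` closure (N t).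
have [|V [VU cV covV]] := lX (W |` range F).
  split=> [A [->//|[t _ <-]]|]; first exact/closed_openC/closed_closure.
  rewrite -subTset => z _; have [Wz|nWz] := pselect (W z).
    by exists W => //; left.
  have /existsNP[t] : ~ forall t, closure (N t) z.
    by move=> clz; apply: nWz; apply: KW.
  by exists (F t) => //; right; exists t.
have /countable_injP[f finj] := cV.
have /choice[e eP] (j : nat) : exists t',
    (exists t, V (F t) /\ f (F t) = j) -> V (F t') /\ f (F t') = j.
  have [[t tP]|no] := pselect (exists t, V (F t) /\ f (F t) = j).
    by exists t.
  by exists t0.
exists e => z nWz.
have [A VA Az] : (\bigcup_(A in V) A) z by rewrite covV.
have [AW|[t _ Ft]] := VU _ VA; first by rewrite AW in Az.
rewrite -Ft in VA Az.
have [VF /finj FE] := eP (f (F t)) (ex_intro _ t (conj VA erefl)).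
by exists (f (F t)); rewrite -[~ _]/(F _ z) FE// inE.
Qed.

(** * Catching points along a countable tree of positions *)

(** A bookkeeping of countably many tasks in which each one comes up again and
    again: at time n, the task is the one coded by the 2-adic valuation of n. *)
Lemma codes_recur (C : countType) (c : C) (N : nat) :
  exists2 n, N <= n & pickle_inv (logn 2 n) = Some c.
Proof.
exists (2 ^ choice.pickle c * N.*2.+1).
  rewrite (leq_trans _ (leq_pmull _ _)) ?expn_gt0//.
  by rewrite -addnn -addnS leq_addr.
rewrite mulnC logn_Gauss ?pfactorK// ?pickleK_inv//.
by rewrite coprime2n /= odd_double.
Qed.

(** An address is a list of pairs (m, j), the most recent first: (m, j) sends a
    node to its j-th child with respect to the union of U_0, ..., U_(m-1).
    Recording m in the address makes a node depend on finitely many U_i only. *)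
Fixpoint node (X T : Type) (e : seq T -> set X -> nat -> T) (U : nat -> set X)
    (a : seq (nat * nat)) : seq T :=
  if a is (m, j) :: a' then
    let l := node e U a' in rcons l (e l (\bigcup_(i in `I_m) U i) j)
  else [::].

Lemma eq_node (X T : Type) (e : seq T -> set X -> nat -> T) U U' n a :
  (forall i, i < n -> U i = U' i) -> all (fun mj => mj.1 <= n) a ->
  node e U a = node e U' a.
Proof.
move=> UU'; elim: a => //= -[m j] a IHa /= /andP[mn /IHa->]; congr rcons.
congr (e _ _ _); apply: eq_bigcupr => i /= im.
by apply: UU'; exact: leq_trans im mn.
Qed.

(** N l t is the set covered at node l when the opponent moves t. The set K of
    points in the closure of every N l t is finite, hence is swallowed by
    W = U_0 `|` ... `|` U_(m-1) once its points have been picked, and then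
    countably many moves t suffice to miss every point outside W. So a
    countable tree of nodes is enough, and picking every point of K at every
    node of it is a countable task. A point z that is never covered lies
    outside W at each node, hence is missed by one of the selected moves, and
    these moves form a branch along which z is missed forever. *)
Lemma point_picker (X : topologicalType) (T : Type) (N : seq T -> T -> set X)
    (x0 : X) (t0 : T) : lindelof X ->
  (forall l, finite_set (\bigcap_t closure (N l t))) ->
  exists p : seq (set X) -> X, forall U : nat -> set X,
    (forall n, open (U n) /\ U n (p (mkseq U n))) ->
    forall z, ~ (\bigcup_n U n) z ->
    exists t : nat -> T, forall n, ~ N (mkseq t n) (t n) z.
Proof.
move=> lX Kfin.
have /choice[q qP] (l : seq T) : exists s : seq X,
    \bigcap_t closure (N l t) = [set` s].
  exact/finite_seqP.
have /choice[e eP] (lW : seq T * set X) : exists f : nat -> T, open lW.2 ->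
    \bigcap_t closure (N lW.1 t) `<=` lW.2 ->
    forall z, ~ lW.2 z -> exists j, ~ closure (N lW.1 (f j)) z.
  case: lW => l W /=.
  have [oW|noW] := pselect (open W); last by exists (fun=> t0).
  have [KW|nKW] := pselect (\bigcap_t closure (N l t) `<=` W); last first.
    by exists (fun=> t0).
  by have [f fP] := lindelof_closure_seq t0 lX oW KW; exists f.
pose nd := node (fun l W => e (l, W)).
pose p (u : seq (set X)) :=
  if pickle_inv (logn 2 (size u)) is Some (a, i) then
    nth x0 (q (nd (nth set0 u) a)) i
  else x0.
exists p => U Uleg z nUz.
have Kcov a i : i < size (q (nd U a)) -> exists m, U m (nth x0 (q (nd U a)) i).
  (* Wait for a time n by which all of the U_i that determine the node a have
     been played. *)
  move=> iq; pose M := \max_(mj <- a) mj.1.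
  have [n Mn nE] := codes_recur (a, i) M; exists n.
  have := (Uleg n).2; rewrite /p size_mkseq nE.
  rewrite (_ : nd (nth set0 (mkseq U n)) a = nd U a)//.
  apply: (@eq_node X T _ _ _ n) => [j jn|]; first by rewrite nth_mkseq.
  apply/allP => mj mja; apply: leq_trans Mn.
  exact: (@leq_bigmax_seq _ a xpredT (fun mj => mj.1)).
have step a : exists mj, ~ N (nd U a) (e (nd U a, \bigcup_(i in `I_mj.1) U i) mj.2) z.
  have /choice[h hP] (i : nat) : exists m, i < size (q (nd U a)) ->
      U m (nth x0 (q (nd U a)) i).
    have [/Kcov[m mP]|_] := ltnP i (size (q (nd U a))).
      by exists m.
    by exists 0.
  (* By time m, every point of the finite set attached to the node is covered. *)
  pose m := (\max_(i < size (q (nd U a))) h i).+1.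
  have [||/= |j nj] := eP (nd U a, \bigcup_(i in `I_m) U i) _ _ z.
  - by apply: bigcup_open => i _; exact: (Uleg i).1.
  - rewrite qP => x /= /(nthP x0)[i iq <-]; exists (h i); last exact: hP.
    by rewrite /= ltnS (@leq_bigmax _ (fun i : 'I__ => h i) (Ordinal iq)).
  - by apply: contra_not nUz => -[i _ Uiz]; exists i.
  - by exists (m, j); apply: contra_not nj => /=; exact: subset_closure.
have [c cP] := choice step.
pose A := fix A n := if n is n'.+1 then c (A n') :: A n' else [::].
exists (fun n => e (nd U (A n), \bigcup_(i in `I_(c (A n)).1) U i) (c (A n)).2) => n.
suff -> : mkseq (fun n => e (nd U (A n),
    \bigcup_(i in `I_(c (A n)).1) U i) (c (A n)).2) n = nd U (A n) by exact: cP.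
elim: n => // n IHn; rewrite mkseqS {}IHn /=.
by case: (c (A n)).
Qed.

(** * Finiteness of the unavoidable points in Hausdorff spaces *)

Definition refines (X : Type) (A A0 : set (set X)) :=
  forall V, A V -> exists2 V0, A0 V0 & V `<=` V0.

Lemma closure_finite_bigcup (X : topologicalType) (C : set (set X)) :
  finite_set C -> closure (\bigcup_(V in C) V) `<=` \bigcup_(V in C) closure V.
Proof.
move=> Cfin; have /closure_id -> : closed (\bigcup_(V in C) closure V).
  by apply: closed_bigcup => // V _; exact: closed_closure.
by apply: closureS => x [V CV Vx]; exists V => //; exact: subset_closure.
Qed.

(** Every y is separated from each of g 0, ..., g (n-1) that differs from it, and
    the intersection of n neighbourhoods is still one. *)
Lemma hausdorff_avoid (X : topologicalType) (g : nat -> X) (y : X) (n : nat) :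
  hausdorff_space X ->
  exists V, [/\ open V, V y & forall i, i < n -> closure V (g i) -> g i = y].
Proof.
rewrite open_hausdorff => hX; elim: n => [|n [V [oV Vy Vg]]].
  by exists setT; split => //; exact: openT.
have [gy|yg] := eqVneq (g n) y.
  exists V; split => // i; rewrite ltnS leq_eqVlt => /predU1P[->//|].
  exact: Vg.
have [[A B] /= [/set_mem Ag /set_mem By] [oA oB /eqP AB0]] := hX _ _ yg.
exists (V `&` B); split => [|//|i]; first exact: openI.
rewrite ltnS leq_eqVlt => /predU1P[->|i_n clg]; last first.
  by apply: Vg => //; apply: closureS clg; exact: subIsetl.
move=> /(_ A) -[|x [[_ Bx] Ax]]; first exact: open_nbhs_nbhs.
by suff : set0 x by []; rewrite -AB0.
Qed.

(** Given k+1 points, a fine enough cover consists of sets whose closures contain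
    at most one of them each, so the closures of k members cannot contain them
    all. Hence the intersection below has at most k points. *)
Lemma bounded_answers_finite (X : topologicalType) (A0 : set (set X))
    (r : set (set X) -> set (set X)) (k : nat) :
  hausdorff_space X -> open_covers X A0 ->
  (forall A, open_covers X A -> refines A A0 -> r A `<=` A /\ r A #<= `I_k) ->
  finite_set (\bigcap_(A in [set A | open_covers X A /\ refines A A0])
                 closure (\bigcup_(V in r A) V)).
Proof.
move=> hX [oA0 A0cov] rP; set K := (X in finite_set X); apply: contrapT => Kinf.
have [x0 _] := infinite_setN0 Kinf.
have [B BK kB] := infinite_set_fset k.+1 Kinf.
pose g i := nth x0 (enum_fset B) i.
pose A := [set V | [/\ open V, exists2 V0, A0 V0 & V `<=` V0 &
  forall i j, i < k.+1 -> j < k.+1 ->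
    closure V (g i) -> closure V (g j) -> g i = g j]].
have Aref : refines A A0 by move=> V [].
have Acov : open_covers X A.
  split=> [V []//|]; rewrite -subTset => y _.
  have [V0 A0V0 V0y] : (\bigcup_(V in A0) V) y by rewrite A0cov.
  have [V [oV Vy Vg]] := hausdorff_avoid g y k.+1 hX.
  exists (V `&` V0) => //; split.
  - by apply: openI => //; exact: oA0.
  - by exists V0.
  - have clV : closure (V `&` V0) `<=` closure V.
      by apply: closureS; exact: subIsetl.
    move=> i j ik jk ci cj.
    exact: etrans (Vg i ik (clV _ ci)) (esym (Vg j jk (clV _ cj))).
have [rA rk] := rP A Acov Aref.
(* Distinct points g i lie in the closures of distinct answers, which gives an
   injection of k+1 points into r A. *)
have /choice[phi phiP] (i : nat) : exists V, i < k.+1 ->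
    r A V /\ closure V (g i).
  have [ik|//] := ltnP i k.+1; last by exists set0.
  have gK : K (g i).
    by apply: BK; rewrite /= /g; apply: mem_nth; exact: leq_trans ik kB.
  have rfin : finite_set (r A) by apply/finite_set_leP; exists k.
  have [V rV Vg] := closure_finite_bigcup rfin (gK _ (conj Acov Aref)).
  by exists V.
suff : `I_k.+1 #<= `I_k by rewrite card_le_II ltnn.
apply: card_le_trans rk.
have /injfunPex[f] : exists2 f : nat -> set X,
  set_fun `I_k.+1 (r A) f & set_inj `I_k.+1 f; last exact: inj_card_le f.
exists phi => [i /phiP[]//|i j /set_mem /= ik /set_mem /= jk eqphi].
have [[rAi ci] [_ cj]] := (phiP i ik, phiP j jk).
have [_ _ sep] := rA _ rAi; rewrite -eqphi in cj.
have /eqP := sep i j ik jk ci cj.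
by rewrite nth_uniq ?fset_uniq ?(leq_trans _ kB)// => /eqP.
Qed.

(** * From points to open sets *)

(** Bob lets p name a point, then chooses a member of Alice's cover around it.
    From inning 1 on his answers are singletons, so p reads the open sets chosen
    so far off the history as the unions of the recorded answers. *)
Lemma point_picker_wins (X : topologicalType) (x0 : X) :
  (forall A0, open_covers X A0 -> exists (B0 : set (set X)) (p : seq (set X) -> X),
    [/\ finite_set B0, B0 `<=` A0 &
     forall U : nat -> set X, (forall n, open (U n) /\ U n (p (mkseq U n))) ->
     forall z, (\bigcup_(V in B0) V) z \/ (\bigcup_n U n) z]) ->
  bob_wins_G_1_mod_1 (open_covers X) (open_covers X).
Proof.
move=> pick.
have /choice[b bP] (A0 : set (set X)) :
    exists b : set (set X) * (seq (set X) -> X), open_covers X A0 ->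
    [/\ finite_set b.1, b.1 `<=` A0 &
     forall U : nat -> set X, (forall n, open (U n) /\ U n (b.2 (mkseq U n))) ->
     forall z, (\bigcup_(V in b.1) V) z \/ (\bigcup_n U n) z].
  have [/pick[B0 [p Bp]]|nA0] := pselect (open_covers X A0).
    by exists (B0, p).
  by exists (set0, fun=> x0).
pose member x A := xget set0 [set V : set X | A V /\ V x].
have memberP x A : open_covers X A -> A (member x A) /\ member x A x.
  move=> [_ covA]; apply: (xgetPex set0 (P := [set V | A V /\ V x])).
  by have [V AV Vx] : (\bigcup_(V in A) V) x; [rewrite covA | exists V].
pose s : strategy (set X) := fun h A => if h is (A0, _) :: h' then
  [set member ((b A0).2 [seq \bigcup_(V in AB.2) V | AB <- h']) A] else (b A).1.
have sleg : legal_strategy (open_covers X) s.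
  move=> [|[A0 B0] h] A oA /=; first by have [] := bP A oA.
  split=> [|_ ->]; first exact: finite_set1.
  by have [] := memberP ((b A0).2 [seq \bigcup_(V in AB.2) V | AB <- h]) A oA.
exists s; split => // A B oA fol.
pose U n := \bigcup_(V in B n.+1) V.
have BS n : B n.+1 = [set member ((b (A 0)).2 (mkseq U n)) (A n.+1)].
  rewrite fol /= -[1]addn0 iotaDl -!map_comp /mkseq.
  by congr [set member (_ _) _]; exact: eq_map.
have Uleg n : open (U n) /\ U n ((b (A 0)).2 (mkseq U n)).
  rewrite {1 2}/U BS bigcup_set1.
  have [Am ?] := memberP ((b (A 0)).2 (mkseq U n)) (A n.+1) (oA _).
  by split => //; exact: (oA n.+1).1.
have [_ _ /(_ U Uleg) cov] := bP _ (oA 0).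
split; last first.
  case=> // n _; rewrite BS.
  by have /card_eqPle[] := @card_set1 _ (member ((b (A 0)).2 (mkseq U n)) (A n.+1)).
split=> [V [n _]|]; first by rewrite fol => /(sleg _ _ (oA n)).2; exact: (oA n).1.
rewrite -subTset => z _; have [[V bV Vz]|[n _ [V BV Vz]]] := cov z.
  by exists V => //; exists 0 => //; rewrite fol.
by exists V => //; exists n.+1.
Qed.

Theorem theorem4p14 (X : topologicalType) (hX : hausdorff_space X) :
  bob_wins_G_bnd (open_covers X) (open_covers X) <->
  bob_wins_G_1_mod_1 (open_covers X) (open_covers X).
Proof.
split=> [bnd|[s [sleg swin]]]; last first.
  exists s; split => // A B oA fol; have [cov one] := swin A B oA fol.
  split => //; have /finite_set_leP[k kP] : finite_set (B 0).
    by rewrite fol; exact: (sleg _ _ (oA 0)).1.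
  exists (maxn k 1) => -[|n].
    by apply: card_le_trans kP _; rewrite card_le_II leq_maxl.
  by apply: card_le_trans (one n.+1 _) _ => //; rewrite card_le_II leq_maxr.
have [[x0 _]|noX] := pselect ([set: X] !=set0); last first.
  have X0 : [set: X] = set0 by apply: contrapT => /eqP/set0P.
  exists (fun _ _ => set0); split=> [h A _|A B _ fol]; first by split.
  have B0 n : B n = set0 by rewrite fol.
  split; last by move=> n _; rewrite B0; exact: card_ge0.
  by rewrite bigcup0//; split; rewrite ?bigcup_set0.
apply: (point_picker_wins x0) => A0 oA0.
have lX := winning_lindelof bnd; have [s [sleg swin]] := bnd.
pose T := {A | open_covers X A /\ refines A A0}.
have A0A0 : refines A0 A0 by move=> V A0V; exists V.
pose t0 : T := exist _ A0 (conj oA0 A0A0); pose c (t : T) := proj1_sig t.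
have cP t : open_covers X (c t) /\ refines (c t) A0 by case: t.
have win (t : nat -> T) := swin _ _ (fun n => (cP (t n)).1)
  (follows_answer s (c \o t)).
(* From l0 on, Bob's answers to covers refining A0 have at most k elements. *)
have [l0 [k l0k]] := @eventually_bounded _ _ t0 c s (fun t => (win t).2).
pose N l t := \bigcup_(V in answer s (map c (l0 ++ l)) (c t)) V.
have [|p pP] := @point_picker X T N x0 t0 lX.
  move=> l; apply: sub_finite_set (bounded_answers_finite (k := k)
    (r := answer s (map c (l0 ++ l))) hX oA0 _) => [x xN A AP|A oA rA].
    exact: (xN (exist _ A AP)).
  split; first exact: (sleg _ _ oA).2.
  exact: (l0k l (exist _ A (conj oA rA))).
(* F collects Bob's answers along l0; as Alice only plays refinements of A0, its
   finitely many members can be replaced by members of A0 itself. *)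
pose F := \bigcup_(i in `I_(size l0))
  answer s (map c (take i l0)) (c (nth t0 l0 i)).
have /choice[phi phiP] (V : set X) : exists V0, F V -> A0 V0 /\ V `<=` V0.
  have [[i _ /(sleg _ _ (cP _).1).2/(cP _).2[V0 A0V0 VV0]]|nFV] := pselect (F V).
    by exists V0.
  by exists set0.
exists (phi @` F), p; split.
- apply/finite_image/bigcup_finite => // i _.
  exact: (sleg _ _ (cP _).1).1.
- by move=> _ [V /phiP[? _] <-].
move=> U Uleg z; have [|nUz] := pselect ((\bigcup_n U n) z); first by right.
left; have [t tP] := pP U Uleg z nUz.
(* The branch t missing z, played after l0, is a play that Bob wins. *)
pose t' i := if i < size l0 then nth t0 l0 i else t (i - size l0).
have t'E n : n <= size l0 -> mkseq t' n = take n l0.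
  move=> nl; apply: (@eq_from_nth _ t0); rewrite size_mkseq ?size_takel// => i i_n.
  by rewrite nth_mkseq// nth_take// /t' (leq_trans i_n nl).
have t'D n : mkseq t' (size l0 + n) = l0 ++ mkseq t n.
  rewrite /mkseq iotaD map_cat -[map _ (iota 0 _)]/(mkseq _ _) t'E// take_size.
  rewrite addnC iotaDl -map_comp; congr (_ ++ _).
  by apply: eq_map => i /=; rewrite /t' ltnNge leq_addr addKn.
have [[_ cov] _] := win t'.
have [V [n _ ansV] Vz] : (\bigcup_(V in \bigcup_n
    answer s (mkseq (c \o t') n) (c (t' n))) V) z by rewrite cov.
have mapE : mkseq (c \o t') n = map c (mkseq t' n) by rewrite /mkseq -map_comp.
rewrite mapE in ansV; have [nl|ln] := ltnP n (size l0).
  have FV : F V by exists n => //; move: ansV; rewrite t'E ?(ltnW nl)// /t' nl.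
  by exists (phi V); [exists V | exact: (phiP V FV).2].
case: (tP (n - size l0)); exists V => //; move: ansV.
by rewrite -t'D subnKC// /t' ltnNge ln.
Qed.
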